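(* Let $\alpha_1,\alpha_2,\beta_1,\beta_2$ be non-negative real numbers with $0\le\alpha_1\le\alpha_2$, $0\le\beta_1\le\beta_2$, $\beta_1>0$, and $\frac{\alpha_1}{\beta_1}=\frac{\alpha_2}{\beta_2}=m$. Then for every $n\in\mathbb{N}$ the nodes $\frac{k+\alpha_2}{n+\beta_2}$ ($k=0,1,\ldots,n$) are more closely clustered around $m$ than the nodes $\frac{k+\alpha_1}{n+\beta_1}$ ($k=0,1,\ldots,n$); that is, for every $k\in\{0,1,\ldots,n\}$, $$\left|\frac{k+\alpha_2}{n+\beta_2}-m\right|\le\left|\frac{k+\alpha_1}{n+\beta_1}-m\right|.$$
   Context: $\mathbb{N}=\{1,2,3,\ldots\}$. For fixed $n$, the points $\frac{k+\alpha}{n+\beta}$, $k=0,1,\ldots,n$, are the nodes of the Bernstein-Stancu operator of degree $n$ with parameters $\alpha,\beta$. ''More closely clustered around $m$'' means that, for each index $k$, the distance of the $k$-th node to $m$ is no larger. *)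

(* Defs.v *)
From Stdlib Require Import Reals.
Open Scope R_scope.

(* The k-th node (0 <= k <= n) of the Bernstein-Stancu operator
   f |-> sum_{k=0}^n f((k+alpha)/(n+beta)) C(n,k) x^k (1-x)^(n-k). *)
Definition stancu_node (alpha beta : R) (n k : nat) : R :=
  (INR k + alpha) / (INR n + beta).

(* The comparison is index by index (not between the two sets of points),
   and it is non-strict. *)
Definition more_closely_clustered (n : nat) (m : R) (x y : nat -> R) : Prop :=
  forall k : nat, (k <= n)%nat -> Rabs (x k - m) <= Rabs (y k - m).

(* Main.v *)
(* With alpha = m beta, the distance of the k-th node to m is |k - n m| / (n + beta),
   which decreases as beta grows. *)
Require Import Defs.
From Stdlib Require Import Reals Lra.
Open Scope R_scope.

(** For [n >= 1] a node is the average of [k/n] and [m = alpha/beta] with weights [n] and [beta], so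
    a larger [beta] pulls it towards [m]. In [stancu_node_dist] the terms [beta * m] cancel, leaving
    a numerator that depends on the parameters only through [m]. *)

Lemma stancu_node_dist (alpha beta : R) (n k : nat) :
  0 < beta ->
  Rabs (stancu_node alpha beta n k - alpha / beta)
    = Rabs (INR k - INR n * (alpha / beta)) / (INR n + beta).
Proof.
  intros hbeta.
  pose proof (pos_INR n) as hn.
  replace (stancu_node alpha beta n k - alpha / beta)
    with ((INR k - INR n * (alpha / beta)) / (INR n + beta))
    by (unfold stancu_node; field; lra).
  unfold Rdiv at 1; rewrite Rabs_mult, Rabs_inv.
  now rewrite (Rabs_pos_eq (INR n + beta)) by lra.
Qed.

Theorem theorem3 (alpha1 alpha2 beta1 beta2 m : R)
  (halpha : 0 <= alpha1 <= alpha2)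
  (hbeta : 0 <= beta1 <= beta2)
  (hbeta1 : 0 < beta1)
  (hm1 : alpha1 / beta1 = m)
  (hm2 : alpha2 / beta2 = m) :
  forall n : nat, (1 <= n)%nat ->
    more_closely_clustered n m (stancu_node alpha2 beta2 n) (stancu_node alpha1 beta1 n).
Proof.
  intros n _ k _.
  pose proof (pos_INR n) as hn.
  (* Each side gets [m] as the ratio of its own parameters, the form [stancu_node_dist] needs; once
     both ratios are [m] again, the numerators agree and only the denominators differ. *)
  rewrite <- hm2 at 1; rewrite <- hm1 at 1.
  rewrite !stancu_node_dist by lra.
  rewrite hm1, hm2.
  apply Rmult_le_compat_l; [apply Rabs_pos|].
  apply Rinv_le_contravar; lra.
Qed.
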